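(* Define the integer sequence $(r_n)_{n\ge 0}$ by $r_0=4$, $r_1=16$ and $r_{n+1}=8r_n-r_{n-1}$ for $n\ge 1$. Let $r\ge 5$ be an integer. The triangle associated with the $D(4)$-triple $\{r-2,r+2,4r\}$, which has side lengths $(r,2r-2,2r+2)$, is Heronian if and only if $r=r_n$ for some $n\ge 1$.
   Context: A $D(4)$-triple is a set of three distinct positive integers such that the product of any two distinct elements, increased by $4$, is a perfect square. The triangle associated with a $D(4)$-triple $\{a,b,c\}$, $a<b<c$, is the triangle with side lengths $\sqrt{ab+4}$, $\sqrt{ac+4}$, $\sqrt{bc+4}$, provided these form a non-degenerate triangle; for $\{r-2,r+2,4r\}$ with $r\ge5$ these lengths are $r$, $2r-2$, $2r+2$ and the triangle is non-degenerate. A Heronian triangle is a triangle with integer side lengths whose area is also an integer. *)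

(* Defs.v *)
From Stdlib Require Import Reals ZArith.

Definition is_square (m : Z) : Prop := exists k : Z, (m = k * k)%Z.

Definition is_D4_triple (a b c : Z) : Prop :=
  ((0 < a /\ 0 < b /\ 0 < c) /\
   (a <> b /\ a <> c /\ b <> c) /\
   is_square (a * b + 4) /\ is_square (a * c + 4) /\ is_square (b * c + 4))%Z.

Definition point : Set := (R * R)%type.

Definition edist (P Q : point) : R :=
  dist_euc (fst P) (snd P) (fst Q) (snd Q).

Record triple_of_points : Set :=
  Vertices { vA : point; vB : point; vC : point }.

Definition side_a (T : triple_of_points) : R := edist (vB T) (vC T).
Definition side_b (T : triple_of_points) : R := edist (vC T) (vA T).
Definition side_c (T : triple_of_points) : R := edist (vA T) (vB T).

(** Cross product of the edge vectors AB and AC: twice the signed area,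
    zero exactly when the three points are collinear. *)
Definition cross (T : triple_of_points) : R :=
  ((fst (vB T) - fst (vA T)) * (snd (vC T) - snd (vA T))
   - (snd (vB T) - snd (vA T)) * (fst (vC T) - fst (vA T)))%R.

Definition nondegenerate (T : triple_of_points) : Prop := cross T <> 0%R.

Definition area (T : triple_of_points) : R := (Rabs (cross T) / 2)%R.

Definition is_integer (x : R) : Prop := exists z : Z, x = IZR z.

Definition is_heronian (T : triple_of_points) : Prop :=
  nondegenerate T /\
  is_integer (side_a T) /\ is_integer (side_b T) /\ is_integer (side_c T) /\
  is_integer (area T).

(** The associated triangle is determined only up to congruence; a realisation
    is any non-degenerate triangle with the prescribed side lengths, with the
    vertices labelled so that the sides come in this order. *)
Definition is_associated_triangle (a b c : Z) (T : triple_of_points) : Prop :=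
  is_D4_triple a b c /\ (a < b < c)%Z /\
  nondegenerate T /\
  side_a T = sqrt (IZR (a * b + 4)) /\
  side_b T = sqrt (IZR (a * c + 4)) /\
  side_c T = sqrt (IZR (b * c + 4)).

Fixpoint r_seq (n : nat) : Z :=
  match n with
  | O => 4
  | S m => match m with
           | O => 16
           | S p => 8 * r_seq m - r_seq p
           end
  end%Z.

(* Main.v *)
(** By Heron's formula the area [A] of a triangle with sides [r], [2r - 2],
    [2r + 2] satisfies [(4A)^2 = 15 r^2 (r^2 - 16)].  If [A] is an integer then
    [r^2 - 16 = 15 m^2] for an integer [m], and reducing modulo [4] twice forces
    [r = 4u], [m = 4v] with [u^2 - 15 v^2 = 1]; conversely such [u], [v] give
    [A = 60 u v].  The solutions of this Pell equation are generated by the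
    fundamental solution [(4, 1)], and [r = 4u] runs through the sequence [r_n]. *)

Require Import Defs.
From Stdlib Require Import Reals ZArith Znumtheory Lia Lra.

(** The coefficients of [(4 + sqrt 15)^n] in the basis [1, sqrt 15]. *)
Fixpoint pell15 (n : nat) : Z * Z :=
  match n with
  | O => (1, 0)
  | S m => let (u, v) := pell15 m in (4 * u + 15 * v, u + 4 * v)
  end%Z.

Lemma pell15_norm (n : nat) :
  (fst (pell15 n) * fst (pell15 n) - 15 * (snd (pell15 n) * snd (pell15 n)) = 1)%Z.
Proof.
  induction n as [|n IH]; [reflexivity|].
  cbn [pell15]; destruct (pell15 n) as [u v]; cbn [fst snd] in *; lia.
Qed.

(** Descent on [v]: for [v > 0] the equation forces [3v < u <= 4v], so [(4u - 15v, 4v - u)] is again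
    a solution, with [0 <= 4v - u < v]. *)
Lemma pell15_complete (u v : Z) :
  (0 < u)%Z -> (0 <= v)%Z -> (u * u - 15 * (v * v) = 1)%Z ->
  exists n, pell15 n = (u, v).
Proof.
  intros Hu Hv; revert u Hu; pattern v.
  apply Zlt_0_ind; [clear v Hv; intros v IH Hv u Hu H | exact Hv].
  destruct (Z.eq_dec v 0) as [->|Hv0].
  - exists 0%nat; simpl; f_equal; nia.
  - assert (u <= 4 * v)%Z by nia.
    assert (3 * v < u)%Z by nia.
    assert (0 < 4 * u - 15 * v)%Z by nia.
    (* Multiplication by the inverse [4 - sqrt 15] of the fundamental unit. *)
    destruct (IH (4 * v - u)%Z ltac:(lia) (4 * u - 15 * v)%Z) as [n Hn]; [lia|lia|].
    exists (S n); cbn [pell15]; rewrite Hn; f_equal; lia.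
Qed.

(** The step matrix of [pell15] has trace 8 and determinant 1, so by Cayley-Hamilton its components
    satisfy the recurrence of [r_seq]. As the recurrence has order two, the induction carries two
    consecutive terms. *)
Lemma r_seq_pell15 (n : nat) : r_seq n = (4 * fst (pell15 n))%Z.
Proof.
  enough (r_seq n = 4 * fst (pell15 n) /\ r_seq (S n) = 4 * fst (pell15 (S n)))%Z
    by tauto.
  induction n as [|n [IH0 IH1]]; [split; reflexivity|].
  split; [exact IH1|].
  change (r_seq (S (S n))) with (8 * r_seq (S n) - r_seq n)%Z.
  rewrite IH0, IH1; cbn [pell15]; destruct (pell15 n) as [u v]; cbn [fst snd]; lia.
Qed.

(** After cancelling the gcd, the cofactors satisfy [a' | b' * b'] and are coprime, so Gauss's lemma
    gives [a' | b']. *)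
Lemma square_divide (a b : Z) : (a * a | b * b)%Z -> (a | b)%Z.
Proof.
  intros Hab.
  destruct (Z.eq_dec a 0) as [->|Ha].
  - destruct Hab as [k Hk]; exists 0%Z; nia.
  - destruct (Z.gcd_divide_l a b) as [a' Ea], (Z.gcd_divide_r a b) as [b' Eb].
    set (g := Z.gcd a b) in *.
    assert (Hg : g <> 0%Z) by (intros E; rewrite E in Ea; lia).
    assert (Hcop : Z.gcd a' b' = 1%Z).
    { assert (E : Z.gcd (a' * g) (b' * g) = g) by (rewrite <- Ea, <- Eb; reflexivity).
      rewrite Z.gcd_mul_mono_r in E.
      assert (0 <= g)%Z by apply Z.gcd_nonneg.
      rewrite Z.abs_eq in E by assumption; nia. }
    assert (Hdiv : (a' | b' * b')%Z).
    { destruct Hab as [k Hk]; exists (k * a')%Z.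
      apply (Z.mul_reg_r _ _ (g * g)); [nia|].
      rewrite Ea, Eb in Hk; lia. }
    apply Z.gauss in Hdiv; [|exact Hcop].
    destruct Hdiv as [q Hq]; exists q; rewrite Ea, Eb, Hq; ring.
Qed.

Lemma divide_15_of_square (k : Z) : (15 | k * k)%Z -> (15 | k)%Z.
Proof.
  intros H.
  assert (Hp : forall p, prime p -> (p | 15)%Z -> (p | k)%Z).
  { intros p Hp Hd; destruct (prime_mult p Hp k k); auto.
    apply Z.divide_trans with 15%Z; assumption. }
  assert (prime_5 : prime 5).
  { apply prime_alt; split; [lia|].
    intros n Hn [q Hq]; assert (n = 2 \/ n = 3 \/ n = 4)%Z by lia; lia. }
  destruct (Hp 3%Z prime_3) as [p Ep]; [exists 5%Z; reflexivity|].
  destruct (Hp 5%Z prime_5) as [q Eq]; [exists 3%Z; reflexivity|].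
  (* From [k = 3p = 5q] follows [15(2q - p) = 6k - 5k = k]. *)
  exists (2 * q - p)%Z; lia.
Qed.

(** Modulo 4 the left side is [x^2 + y^2], which vanishes only if both are even. *)
Lemma even_even_of_norm (x y c : Z) :
  (x * x - 15 * (y * y) = 4 * c)%Z ->
  exists u v, (x = 2 * u /\ y = 2 * v /\ u * u - 15 * (v * v) = c)%Z.
Proof.
  intros H.
  destruct (Z.Even_or_Odd x) as [[u Hu]|[u Hu]],
           (Z.Even_or_Odd y) as [[v Hv]|[v Hv]]; subst; try lia.
  exists u, v; lia.
Qed.

Lemma heron_square_pell (r A : Z) :
  (r <> 0 -> 16 * (A * A) = 15 * (r * r) * (r * r - 16) ->
   exists u v, r = 4 * u /\ u * u - 15 * (v * v) = 1)%Z.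
Proof.
  intros Hr H.
  (* The hypothesis shows [r^2 | (4A)^2]. Writing [4A = k r] and cancelling [r^2] leaves
     [k^2 = 15 (r^2 - 16)], hence [15 | k]. *)
  destruct (square_divide r (4 * A)) as [k Hk].
  { exists (15 * (r * r - 16))%Z; lia. }
  assert (Hk2 : (k * k = 15 * (r * r - 16))%Z).
  { apply (Z.mul_reg_r _ _ (r * r)); [nia|].
    transitivity ((k * r) * (k * r))%Z; [ring|]; rewrite <- Hk; lia. }
  destruct (divide_15_of_square k) as [m Hm].
  { exists (r * r - 16)%Z; lia. }
  (* With [k = 15m] the norm [r^2 - 15 m^2] is 16; two halvings bring it to 4, then to 1. *)
  destruct (even_even_of_norm r m 4) as (x & y & -> & -> & H1); [nia|].
  destruct (even_even_of_norm x y 1) as (u & v & -> & -> & H2); [lia|].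
  exists u, v; lia.
Qed.

Lemma heron_square_iff_r_seq (r : Z) :
  (5 <= r)%Z ->
  (exists A, 16 * (A * A) = 15 * (r * r) * (r * r - 16))%Z <->
  exists n, (1 <= n)%nat /\ r = r_seq n.
Proof.
  intros hr; split.
  - intros [A H].
    destruct (heron_square_pell r A) as (u & v & Hu & Huv); [lia|exact H|].
    (* The sign of [v] is not controlled, but only [v^2] enters the equation. *)
    destruct (pell15_complete u (Z.abs v)) as [n Hn]; [lia|lia|nia|].
    assert (Er : r = r_seq n) by (rewrite r_seq_pell15, Hn; exact Hu).
    exists n; split; [|exact Er].
    (* Index 0 would give [r = 4], against [5 <= r]. *)
    destruct n; [simpl in Er; lia|lia].
  - intros (n & _ & Er).
    pose proof (pell15_norm n) as Hn.
    rewrite r_seq_pell15 in Er; destruct (pell15 n) as [u v]; cbn [fst snd] in *.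
    exists (60 * (u * v))%Z.
    rewrite Er.
    replace (4 * u * (4 * u) - 16)%Z with (16 * 15 * (v * v))%Z by lia; ring.
Qed.

Open Scope R_scope.

Lemma edist_square (P Q : point) :
  edist P Q * edist P Q =
  (fst P - fst Q) * (fst P - fst Q) + (snd P - snd Q) * (snd P - snd Q).
Proof.
  unfold edist, dist_euc; apply sqrt_sqrt.
  apply Rplus_le_le_0_compat; apply Rle_0_sqr.
Qed.

Lemma area_nonneg (T : triple_of_points) : 0 <= area T.
Proof. unfold area; pose proof (Rabs_pos (cross T)); lra. Qed.

(** In this form Heron's formula involves only squared lengths, so it becomes a polynomial identity
    in the coordinates. *)
Lemma heron (T : triple_of_points) :
  let a2 := side_a T * side_a T in
  let b2 := side_b T * side_b T in
  let c2 := side_c T * side_c T in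
  16 * (area T * area T) = 4 * (a2 * b2) - (a2 + b2 - c2) * (a2 + b2 - c2).
Proof.
  cbv zeta; unfold side_a, side_b, side_c; rewrite !edist_square.
  assert (E : 16 * (area T * area T) = 4 * (cross T * cross T)).
  { unfold area.
    transitivity (4 * (Rabs (cross T) * Rabs (cross T))); [field|].
    rewrite <- Rabs_mult, Rabs_pos_eq; [reflexivity | apply Rle_0_sqr]. }
  rewrite E; unfold cross; ring.
Qed.

Lemma edist_eq (P Q : point) (d : R) :
  0 <= d ->
  (fst P - fst Q) * (fst P - fst Q) + (snd P - snd Q) * (snd P - snd Q) = d * d ->
  edist P Q = d.
Proof.
  intros Hd H; unfold edist, dist_euc, Rsqr; rewrite H; apply sqrt_square, Hd.
Qed.

Lemma sqrt_IZR_square (m k : Z) :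
  (0 <= k)%Z -> (m = k * k)%Z -> sqrt (IZR m) = IZR k.
Proof.
  intros Hk ->; rewrite mult_IZR; apply sqrt_square, IZR_le, Hk.
Qed.

Lemma triangle_exists (r : R) :
  4 < r -> exists T : triple_of_points,
    nondegenerate T /\ side_a T = r /\ side_b T = 2 * r - 2 /\ side_c T = 2 * r + 2.
Proof.
  intros hr.
  (* Put [B = (0, 0)], [C = (r, 0)], [A = (x, y)]. Subtracting the equations for [AB = 2r + 2] and
     [CA = 2r - 2] gives [2xr - r^2 = 16r], so [x = (r + 16) / 2], and then
     [y^2 = (2r + 2)^2 - x^2]. *)
  set (y := sqrt (15 * (r * r - 16) / 4)).
  assert (Hpos : 0 < 15 * (r * r - 16) / 4) by nra.
  assert (Hy : 0 < y) by (apply sqrt_lt_R0, Hpos).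
  assert (Hyy : y * y = 15 * (r * r - 16) / 4) by (apply sqrt_sqrt; lra).
  exists (Vertices ((r + 16) / 2, y) (0, 0) (r, 0)).
  repeat split.
  - unfold nondegenerate, cross; simpl; nra.
  - apply edist_eq; simpl; nra.
  - apply edist_eq; simpl; nra.
  - apply edist_eq; simpl; nra.
Qed.

Theorem proposition4p6 (r : Z) (hr : (5 <= r)%Z) :
  is_D4_triple (r - 2) (r + 2) (4 * r) /\
  (exists T : triple_of_points,
     is_associated_triangle (r - 2) (r + 2) (4 * r) T) /\
  (forall T : triple_of_points,
     is_associated_triangle (r - 2) (r + 2) (4 * r) T ->
     (side_a T = IZR r /\
      side_b T = IZR (2 * r - 2) /\
      side_c T = IZR (2 * r + 2)) /\
     (is_heronian T <-> exists n : nat, (1 <= n)%nat /\ r = r_seq n)).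
Proof.
  assert (HD4 : is_D4_triple (r - 2) (r + 2) (4 * r)).
  { repeat split; try lia.
    - exists r; ring.
    - exists (2 * r - 2)%Z; ring.
    - exists (2 * r + 2)%Z; ring. }
  assert (Ea : sqrt (IZR ((r - 2) * (r + 2) + 4)) = IZR r)
    by (apply sqrt_IZR_square; lia).
  assert (Eb : sqrt (IZR ((r - 2) * (4 * r) + 4)) = IZR (2 * r - 2))
    by (apply sqrt_IZR_square; lia).
  assert (Ec : sqrt (IZR ((r + 2) * (4 * r) + 4)) = IZR (2 * r + 2))
    by (apply sqrt_IZR_square; lia).
  split; [exact HD4|]; split.
  - destruct (triangle_exists (IZR r)) as (T & Hnd & Ha & Hb & Hc).
    { apply IZR_lt; lia. }
    exists T; unfold is_associated_triangle; rewrite Ea, Eb, Ec.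
    rewrite minus_IZR, plus_IZR, !mult_IZR.
    repeat split; try apply HD4; try lia; assumption.
  - intros T (_ & _ & Hnd & Ha & Hb & Hc).
    rewrite Ea in Ha; rewrite Eb in Hb; rewrite Ec in Hc.
    split; [auto|].
    assert (Harea : 16 * (area T * area T) = IZR (15 * (r * r) * (r * r - 16))).
    { rewrite heron, Ha, Hb, Hc.
      repeat rewrite ?minus_IZR, ?plus_IZR, ?mult_IZR; ring. }
    rewrite <- heron_square_iff_r_seq by exact hr.
    split.
    + intros (_ & _ & _ & _ & A & HA).
      exists A; apply eq_IZR; rewrite <- Harea, HA, !mult_IZR; reflexivity.
    + intros [A HA].
      (* [A] may be negative while the area is not, so the witness is its absolute value, and it
         suffices to compare squares. *)
      repeat split; [exact Hnd | eexists; eassumption .. | exists (Z.abs A)].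
      apply Rsqr_inj; [apply area_nonneg | apply IZR_le; lia |].
      unfold Rsqr; rewrite <- mult_IZR, <- Z.abs_mul, Z.abs_eq by nia.
      rewrite <- HA, !mult_IZR in Harea; rewrite mult_IZR; lra.
Qed.
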